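(* Let $M$ be a Garside monoid with Garside element $\Delta$ and group of fractions $G$, and let $a\in G$. For $u,v$ (conjugate) elements of $C^{sum}(a)$, there exists a sequence $u=u_1,\ldots,u_k=v$ of elements of $C^{sum}(a)$ such that, for $i=1,\ldots,k-1$, the elements $u_i$ and $u_{i+1}$ are conjugated by an element of $S_{u_i}^{sum}$, that is, $u_{i+1}=s_i^{-1}u_is_i$ for some $s_i\in S_{u_i}^{sum}$.
   Context: In a cancellative monoid $M$ with no invertible elements other than $1$, write $a\prec b$ if $ac=b$ for some $c\in M$ ($a$ is a left divisor of $b$) and $b\succ a$ if $b=ca$ for some $c\in M$ ($a$ is a right divisor of $b$). An atom is an element $x\neq 1$ such that $x=yz$ implies $y=1$ or $z=1$. $M$ is atomic if it is generated by its atoms and for every $x\in M$ there is an integer $N_x>0$ such that $x$ is not a product of more than $N_x$ atoms. $M$ is Gaussian if it is atomic, left and right cancellative, and every pair of elements has a (left and right) lcm and a (left and right) gcd; $a\wedge b$ denotes the left gcd, i.e. with respect to $\prec$. A Garside element is an element $\Delta\in M$ whose left divisors coincide with its right divisors, form a finite set, and generate $M$; a Garside monoid is a Gaussian monoid having a Garside element $\Delta$ (fixed). The divisors of $\Delta$ are the simple elements, and $S$ is the finite set of them. $M$ embeds in its group of fractions $G$ and is regarded as a subset of $G$. Every $a\in G$ has a unique left normal form $a=\Delta^pa_1\cdots a_l$, where $p=\max\{r\in\mathbb{Z}:\Delta^{-r}a\in M\}$ and $a_i=\Delta\wedge(a_i\cdots a_l)\in S\setminus\{1,\Delta\}$ for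 all $i$. The canonical length of $a$ is $\|a\|=l$. $C(a)$ is the conjugacy class of $a$ in $G$, and $C^{sum}(a)$ is the subset of $C(a)$ consisting of all elements of minimal canonical length. For $v\in C^{sum}(a)$, a simple element $s$ satisfies property $\mathcal{P}_v^{sum}$ if $s^{-1}vs\in C^{sum}(a)$. $S_v^{sum}$ is the set of $\prec$-minimal elements among the nontrivial ($\neq 1$) simple elements satisfying $\mathcal{P}_v^{sum}$. *)

(* Defs.v *)
From HB Require Import structures.
From mathcomp Require Import all_boot all_order all_algebra.
From mathcomp Require Import boolp classical_sets cardinality.

Set Implicit Arguments.
Unset Strict Implicit.
Unset Printing Implicit Defensive.

Local Open Scope classical_set_scope.
Local Open Scope group_scope.

(* [ldiv a b] is a \prec b; [rdiv a b] is b \succ a. *)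
Definition ldiv (M : monoidType) (a b : M) : Prop := exists c, a * c = b.
Definition rdiv (M : monoidType) (a b : M) : Prop := exists c, b = c * a.

Definition is_gcd (M : monoidType) (dvd : M -> M -> Prop) (a b d : M) : Prop :=
  [/\ dvd d a, dvd d b & forall e, dvd e a -> dvd e b -> dvd e d].

Definition is_lcm (M : monoidType) (dvd : M -> M -> Prop) (a b m : M) : Prop :=
  [/\ dvd a m, dvd b m & forall e, dvd a e -> dvd b e -> dvd m e].

Definition atom (M : monoidType) (x : M) : Prop :=
  x <> 1 /\ forall y z, x = y * z -> y = 1 \/ z = 1.

(* [x] is the product of the finite sequence [s] of elements of [A]. *)
Definition factorization (M : monoidType) (A : set M) (x : M) (s : seq M) :
    Prop :=
  (forall y, y \in s -> A y) /\ \prod_(y <- s) y = x.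

Definition generates (M : monoidType) (A : set M) : Prop :=
  forall x, exists s, factorization A x s.

Definition atomic (M : monoidType) : Prop :=
  generates (@atom M) /\
  forall x : M, exists2 N : nat, (0 < N)%N &
    forall s, factorization (@atom M) x s -> (size s <= N)%N.

Record gaussian (M : monoidType) : Prop := Gaussian {
  gaussian_units : forall x y : M, x * y = 1 -> y * x = 1 -> x = 1;
  gaussian_atomic : atomic M;
  gaussian_cancell : forall x y z : M, x * y = x * z -> y = z;
  gaussian_cancelr : forall x y z : M, y * x = z * x -> y = z;
  gaussian_lgcd : forall a b : M, exists d, is_gcd (@ldiv M) a b d;
  gaussian_rgcd : forall a b : M, exists d, is_gcd (@rdiv M) a b d;
  gaussian_llcm : forall a b : M, exists m, is_lcm (@ldiv M) a b m;
  gaussian_rlcm : forall a b : M, exists m, is_lcm (@rdiv M) a b m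
}.

Definition simple (M : monoidType) (Delta : M) : set M :=
  [set x | ldiv x Delta].

Record garside_element (M : monoidType) (Delta : M) : Prop := GarsideElement {
  garside_lrdiv : forall x, ldiv x Delta <-> rdiv x Delta;
  garside_finite : finite_set (simple Delta);
  garside_generates : generates (simple Delta)
}.

Definition garside_monoid (M : monoidType) (Delta : M) : Prop :=
  gaussian M /\ garside_element Delta.

(* For a cancellative monoid with common multiples, such a pair (G, iota)
   exists and is unique up to a unique isomorphism (Ore). *)
Record group_of_fractions (M : monoidType) (G : groupType)
    (iota : UMagmaMorphism.type M G) : Prop := GroupOfFractions {
  fractions_inj : injective iota;
  fractions_div : forall g : G, exists x y : M, g = iota x / iota y
}.

Definition expgz (G : groupType) (x : G) (n : int) : G :=
  match n with
  | Posz k => x ^+ k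
  | Negz k => x ^- k.+1
  end.

Section Garside.

Variables (M : monoidType) (G : groupType) (iota : UMagmaMorphism.type M G).
Variable Delta : M.

Definition is_inf (g : G) (p : int) : Prop :=
  range iota (expgz (iota Delta) (- p)%R * g) /\
  forall r : int, range iota (expgz (iota Delta) (- r)%R * g) -> (r <= p)%R.

(* Entries are numbered from 0: the tail product of [drop i s] is
   a_(i+1) ... a_l. *)
Definition left_normal_form (g : G) (p : int) (s : seq M) : Prop :=
  [/\ is_inf g p,
      g = expgz (iota Delta) p * iota (\prod_(x <- s) x) &
      forall i, (i < size s)%N ->
        [/\ simple Delta s`_i, s`_i <> 1, s`_i <> Delta &
            is_gcd (@ldiv M) Delta (\prod_(x <- drop i s) x) s`_i]].

(* The default value 0 is only relevant when Delta = 1, i.e., when M and G are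
   trivial and no element has an infimum. *)
Definition canonical_length (g : G) : nat :=
  xget 0%N [set l | exists p s, left_normal_form g p s /\ size s = l].

Definition conj_class (a : G) : set G := [set v | exists g, v = a ^ g].

Definition Csum (a : G) : set G :=
  [set v | conj_class a v /\
    forall w, conj_class a w -> (canonical_length v <= canonical_length w)%N].

Definition Psum (a v : G) (s : M) : Prop :=
  simple Delta s /\ Csum a (v ^ iota s).

Definition Ssum (a v : G) : set M :=
  [set s | [/\ Psum a v s, s <> 1 &
    forall t, Psum a v t -> t <> 1 -> ldiv t s -> t = s]].

End Garside.

(* Main.v *)
Require Import Defs.
From mathcomp Require Import all_boot all_order all_algebra.
From mathcomp Require Import boolp classical_sets cardinality.
From mathcomp Require Import fingroup perm.
From mathcomp Require Import zify.

(** Left divisibility extends to an order on the group of fractions [G]: write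
g <= h when [g^-1 * h] lies in [M].  It is invariant under left
multiplication and, because conjugation by [Delta] permutes [M], also under
right multiplication by powers of [Delta]; moreover left gcds taken in [M]
remain greatest lower bounds in [G] ([le_gcd]).  Hence for every u in [G] and
every integer p the map g |-> u^-1 g Delta^p ([shift]) is order preserving, and
  Delta^p <= g^-1 u g   iff   u^-1 g Delta^p <= g,
  g^-1 u g <= Delta^q   iff   u g Delta^-q <= g.
So bounding the infimum and the supremum of a conjugate of u means that the
conjugating element is sent below itself by some of these maps ([contracted]).

Two consequences carry the proof.

Elements sent below themselves by an order preserving map are stable under
meets ([contracted_gcd]).  If u and u^x satisfy the same two bounds then so does
the conjugate of u by [Delta], hence also the conjugate of u by the left gcd of
[Delta] and x.

The best infimum and the best supremum in a conjugacy class are reached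
together ([conj_inf_sup]).  Suppose that u <= Delta^q, and let y be the least
element of [M] such that Delta^p <= u^y.  The map g |-> u^-1 g Delta^q commutes
with g |-> u^-1 g Delta^p, and it sends 1 above 1; so it sends y to an element
above 1 satisfying the same condition as y.  By minimality y <= u^-1 y Delta^q,
that is u^y <= Delta^q.

The canonical length of g is the difference of the least q and the greatest p with
Delta^p <= g <= Delta^q ([canonical_length_between], [canonical_length_le]).  By
the second consequence all elements of minimal length in a class share the same
p and q ([Csum_between]); by the first one, if u and u^x have minimal length,
then so has the conjugate of u by the gcd of [Delta] and x
([Csum_gcd_Delta]).  Therefore a nontrivial x has a left divisor in the set of
minimal simple conjugators of u ([Ssum_ldiv]).  A power of [Delta] is
central, so conjugate elements are conjugate by an element x of [M]
([conj_positive]), and splitting off minimal simple divisors of x one at a time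
terminates because the lengths of atom factorizations are bounded. *)

Set Implicit Arguments.
Unset Strict Implicit.
Unset Printing Implicit Defensive.

Local Open Scope group_scope.

(** * Divisibility and length in an atomic monoid *)

Section Divisibility.

Variable M : monoidType.

Lemma ldiv_refl (x : M) : ldiv x x.
Proof. by exists 1; rewrite mulg1. Qed.

Lemma ldiv_trans (y x z : M) : ldiv x y -> ldiv y z -> ldiv x z.
Proof. by move=> [b <-] [c <-]; exists (b * c); rewrite mulgA. Qed.

(** The bound on the lengths of atom factorizations is used only through such a
function; it makes proper left divisibility well founded. *)
Record strict_length (len : M -> nat) : Prop := StrictLength {
  len_superadd : forall x y, (len x + len y <= len (x * y)%g)%N;
  len_eq0 : forall x, len x = 0%N -> x = 1
}.

(** The maximal number of atoms in a factorization works: factorizations of [x]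
and [y] concatenate to one of [x * y], and an element whose factorizations are
all empty is [1]. *)
Lemma atomic_length : atomic M -> exists len, strict_length len.
Proof.
move=> [gen bnd].
pose P x n := exists2 s, factorization (@atom M) x s & size s = n.
have maxP x : exists n, P x n /\ forall m, P x m -> (m <= n)%N.
  have ex : exists n, `[< P x n >].
    have [s sx] := gen x; exists (size s).
    by apply/asboolP; exists s.
  have [N _ leN] := bnd x.
  have le n : `[< P x n >] -> (n <= N)%N.
    by move=> /asboolP[s /leN + <-].
  case: (ex_maxnP ex le) => n /asboolP Pn maxn.
  by exists n; split=> // m Pm; apply/maxn/asboolP.
have [len lenP] := choice maxP; exists len; split=> [x y | x len0].
  have [[s [sA sx] <-] _] := lenP x.
  have [[t [tA ty] <-] _] := lenP y.
  apply: (lenP (x * y)).2; exists (s ++ t); last by rewrite size_cat.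
  split=> [z|]; last by rewrite big_cat /= sx ty.
  by rewrite mem_cat => /orP[/sA | /tA].
have [[s [_ xs] szs] _] := lenP x.
by move: szs xs; rewrite len0 => /size0nil ->; rewrite big_nil.
Qed.

Section Length.

Variable len : M -> nat.
Hypothesis lenP : strict_length len.

Lemma len_ldiv (x y : M) : ldiv x y -> (len x <= len y)%N.
Proof.
by move=> [c <-]; apply: leq_trans (len_superadd lenP x c); rewrite leq_addr.
Qed.

Lemma ldiv1 (x : M) : ldiv x 1 -> x = 1.
Proof.
move=> /len_ldiv len_x; apply: (len_eq0 lenP).
by have := len_superadd lenP 1 1; rewrite mulg1; lia.
Qed.

Lemma len_ltMr (x y : M) : x <> 1 -> (len y < len (x * y)%g)%N.
Proof.
move=> x_neq1; apply: leq_trans (len_superadd lenP x y).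
rewrite -add1n leq_add2r lt0n; apply/eqP => len0; exact/x_neq1/(len_eq0 lenP).
Qed.

Lemma len_exp (x : M) n : x <> 1 -> (n <= len (x ^+ n)%g)%N.
Proof.
move=> x_neq1; elim: n => // n IHn; rewrite expgS.
exact: leq_ltn_trans IHn (len_ltMr _ x_neq1).
Qed.

Lemma ldiv_minimal (A : M -> Prop) x : A x ->
  exists2 y, A y /\ ldiv y x & forall z, A z -> ldiv z y -> z = y.
Proof.
have [n] := ubnP (len x); elim: n x => // n IHn x; rewrite ltnS => lexn Ax.
have [minx|] := pselect (forall z, A z -> ldiv z x -> z = x).
  by exists x => //; split=> //; apply: ldiv_refl.
move=> /existsNP[z] /not_implyP[Az] /not_implyP[[c zc] zx].
have ltzx : (len z < len x)%N.
  case: (posnP (len c)) => [/(len_eq0 lenP) c1 | c_gt0].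
    by case: zx; rewrite -zc c1 mulg1.
  by rewrite -zc; apply: leq_trans (len_superadd lenP z c); lia.
have [y [Ay zy] miny] := IHn z (leq_trans ltzx lexn) Az.
by exists y => //; split=> //; apply: ldiv_trans zy _; exists c.
Qed.

End Length.

End Divisibility.

(** * Integer powers in a group *)

Section IntegerPowers.

Variables (G : groupType) (x : G).

Lemma expgz_succ (p : int) : expgz x (p + 1)%R = expgz x p * x.
Proof.
case: p => [n|[|n]].
- have ->: (n%:Z + 1)%R = Posz n.+1 by lia.
  by rewrite /= expgSr.
- by rewrite [RHS]mulVg.
have ->: (Negz n.+1 + 1)%R = Negz n by lia.
by rewrite /= [x ^+ n.+2]expgS invgM mulgVK.
Qed.

Lemma expgzD (p q : int) : expgz x (p + q)%R = expgz x p * expgz x q.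
Proof.
elim/int_ind: q => [|n IHn|n IHn]; first by rewrite GRing.addr0 /= mulg1.
  have ->: (p + n.+1%:Z)%R = (p + n%:Z + 1)%R by lia.
  by rewrite expgz_succ IHn -mulgA /= -expgSr.
apply: (mulIg x); rewrite -mulgA -!expgz_succ.
have ->: (p - n.+1%:Z + 1)%R = (p - n%:Z)%R by lia.
by rewrite IHn; have ->: (- n.+1%:Z + 1)%R = (- n%:Z)%R by lia.
Qed.

Lemma expgzN (p : int) : expgz x (- p)%R = (expgz x p)^-1.
Proof. by apply: (mulIg (expgz x p)); rewrite -expgzD GRing.addNr mulVg. Qed.

Lemma commute_expgz (p q : int) : commute (expgz x p) (expgz x q).
Proof. by rewrite /commute -!expgzD GRing.addrC. Qed.

End IntegerPowers.

(** * Conjugation by the Garside element *)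

Section Garside.

Variables (M : monoidType) (Delta : M).
Hypothesis garsideM : garside_monoid Delta.

Let gaussM : gaussian M := garsideM.1.
Let garsideD : garside_element Delta := garsideM.2.

(** If [x * y = Delta], then [y] divides [Delta] on the right, hence on the left;
its left complement [z] satisfies [x * Delta = x * y * z = Delta * z]. *)
Lemma simple_slide (x : M) :
  simple Delta x -> exists2 y, simple Delta y & x * Delta = Delta * y.
Proof.
move=> [y xy]; have /(garside_lrdiv garsideD)[z yz] : rdiv y Delta.
  by exists x.
exists z; first by apply/(garside_lrdiv garsideD); exists y.
by rewrite -{1}yz mulgA xy.
Qed.

Lemma simple_slideV (y : M) :
  simple Delta y -> exists x, x * Delta = Delta * y.
Proof.
move=> /(garside_lrdiv garsideD)[w wy].
have /(garside_lrdiv garsideD)[t tw] : ldiv w Delta by exists y.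
by exists t; rewrite {2}tw -mulgA -wy.
Qed.

Lemma slide (x : M) : exists y, x * Delta = Delta * y.
Proof.
have [s [sS <-]] := garside_generates garsideD x.
elim: s sS => [|y s IHs] sS; first by exists 1; rewrite big_nil mul1g mulg1.
have [|z sz] := IHs; first by move=> t ts; apply: sS; rewrite inE ts orbT.
have [|t _ yt] := @simple_slide y; first by apply: sS; rewrite mem_head.
by exists (t * z); rewrite big_cons -mulgA sz !mulgA yt.
Qed.

Lemma slideV (y : M) : exists x, x * Delta = Delta * y.
Proof.
have [s [sS <-]] := garside_generates garsideD y.
elim: s sS => [|x s IHs] sS; first by exists 1; rewrite big_nil mul1g mulg1.
have [|z sz] := IHs; first by move=> t ts; apply: sS; rewrite inE ts orbT.
have [|t xt] := @simple_slideV x; first by apply: sS; rewrite mem_head.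
by exists (t * z); rewrite big_cons -mulgA sz !mulgA xt.
Qed.

Lemma slideX k (x : M) : exists y, x * Delta ^+ k = Delta ^+ k * y.
Proof.
elim: k x => [|k IHk] x; first by exists x; rewrite mulg1 mul1g.
have [y xy] := slide x; have [z yz] := IHk y.
by exists z; rewrite expgS mulgA xy -!mulgA yz.
Qed.

(** Complete [s] inductively: the complement of the first letter slides through
the power of [Delta] completing the tail. *)
Lemma simple_prod_ldiv (s : seq M) : (forall x, x \in s -> simple Delta x) ->
  ldiv (\prod_(x <- s) x) (Delta ^+ size s).
Proof.
elim: s => [|x s IHs] sS; first by rewrite big_nil; apply: ldiv_refl.
have [|c sc] := IHs; first by move=> t ts; apply: sS; rewrite inE ts orbT.
have [y xy] := sS _ (mem_head x s); have [z yz] := slideX (size s) y.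
exists (c * z).
by rewrite big_cons -mulgA (mulgA _ c) sc -yz mulgA xy expgS.
Qed.

Lemma ldiv_DeltaX (x : M) : exists k, ldiv x (Delta ^+ k).
Proof.
have [s [sS <-]] := garside_generates garsideD x.
by exists (size s); apply: simple_prod_ldiv.
Qed.

(** Conjugation by [Delta] is a permutation of the finite set of simple elements,
hence has finite order on it; and the simple elements generate [M]. *)
Lemma DeltaX_central :
  exists2 e, (0 < e)%N & forall x : M, commute x (Delta ^+ e).
Proof.
have [S defS] := (finite_seqP _).1 (garside_finite garsideD).
have memS x : x \in S <-> simple Delta x by rewrite defS.
have tauP (x : seq_sub S) : exists y : seq_sub S, val x * Delta = Delta * val y.
  have [y yS xy] := simple_slide ((memS _).1 (valP x)).
  by exists (SeqSub ((memS _).2 yS)).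
have [tau tauE] := choice tauP.
have tau_inj : injective tau.
  move=> x y eq_tau; apply/val_inj/(gaussian_cancelr gaussM (x := Delta)).
  by rewrite !tauE eq_tau.
pose e := #[perm tau_inj]%g; exists e; first exact: order_gt0.
have tauX k x : val x * Delta ^+ k = Delta ^+ k * val (iter k tau x).
  elim: k => [|k IHk]; first by rewrite mulg1 mul1g.
  by rewrite !expgSr mulgA IHk -!mulgA tauE.
move=> x; have [s [sS <-]] := garside_generates garsideD x.
elim: s sS => [|y s IHs] sS; first by rewrite big_nil /commute mul1g mulg1.
rewrite big_cons; apply/commute_sym/commuteM; last first.
  by apply/commute_sym/IHs => t ts; apply: sS; rewrite inE ts orbT.
have yS : y \in S by apply/memS/sS; rewrite mem_head.
rewrite /commute -[y]/(val (SeqSub yS)) tauX.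
rewrite -(eq_iter (permE tau_inj)) -permX expg_order perm1 //.
Qed.

(** * The order on the group of fractions *)

Section Fractions.

Variables (G : groupType) (iota : UMagmaMorphism.type M G).
Hypothesis fractionsG : group_of_fractions iota.

Local Notation D := (iota Delta).
Local Notation "D^ p" := (expgz (iota Delta) p) (at level 10, p at level 9).

Definition positive : set G := range iota.

Lemma positive_iota x : positive (iota x).
Proof. by exists x. Qed.

Lemma positive1 : positive 1.
Proof. by rewrite -(gmulf1 (s := iota)); apply: positive_iota. Qed.

Lemma positiveM g h : positive g -> positive h -> positive (g * h).
Proof.
by move=> [x _ <-] [y _ <-]; rewrite -gmulfM; apply: positive_iota.
Qed.

Lemma positiveJ (p : int) g : positive g -> positive (g ^ D^ p).
Proof.
suff posD h : positive h -> positive (h ^ D) /\ positive (h ^ D^-1).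
  elim/int_ind: p g => [|n IHn|n IHn] g posg; first by rewrite conjg1.
    have ->: Posz n.+1 = (Posz n + 1)%R by lia.
    by rewrite expgz_succ conjgM; case: (posD _ (IHn _ posg)).
  have ->: D^ (- n.+1%:Z)%R = D^ (- n%:Z)%R * D^-1.
    by apply: (mulIg D); rewrite mulgVK -expgz_succ; congr expgz; lia.
  by rewrite conjgM; case: (posD _ (IHn _ posg)).
move=> [x _ <-]; have [[y xy] [z zx]] := (slide x, slideV x); split.
  exists y => //; apply: (mulgI D).
  by rewrite conjgE mulVKg -!gmulfM xy.
exists z => //; apply: (mulIg D).
by rewrite conjgE invgK mulgA mulgVK -!gmulfM zx.
Qed.

Lemma fraction_DeltaX (g : G) : exists k : nat, positive (D ^+ k * g).
Proof.
have [x [y ->]] := fractions_div fractionsG g.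
have [k [c yc]] := ldiv_DeltaX y; exists k.
have ->: (iota y)^-1 = iota c * D ^- k.
  by apply: (mulgI (iota y)); rewrite mulgV mulgA -gmulfM yc gmulfXn mulgV.
rewrite (_ : _ * _ = (iota x * iota c) ^ D^ (- k%:Z)%R).
  by apply/positiveJ/positiveM; apply: positive_iota.
by rewrite conjgE expgzN invgK !mulgA.
Qed.

Definition le (g h : G) := positive (g^-1 * h).

Lemma le_trans g f h : le f g -> le g h -> le f h.
Proof.
move=> fg gh; rewrite /le; have ->: f^-1 * h = (f^-1 * g) * (g^-1 * h).
  by rewrite mulgA mulgK.
exact: positiveM.
Qed.

Lemma le_mul2l f g h : le g h -> le (f * g) (f * h).
Proof. by rewrite /le invgM -mulgA mulKg. Qed.

Lemma le_mulDeltaz p g h : le g h -> le (g * D^ p) (h * D^ p).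
Proof.
move=> /(positiveJ p); rewrite /le invgM -mulgA mulgA.
by rewrite conjgE !mulgA.
Qed.

Lemma le_mulr g m : positive m -> le g (g * m).
Proof. by rewrite /le mulKg. Qed.

Lemma le_iota x y : le (iota x) (iota y) <-> ldiv x y.
Proof.
split=> [[c _ xc]|[c <-]]; last first.
  by rewrite gmulfM; apply/le_mulr/positive_iota.
by exists c; apply: (fractions_inj fractionsG); rewrite gmulfM xc mulVKg.
Qed.

(** The element [g] need not lie in [M].  For [k] large enough [D ^+ k * g] does,
and it is a common divisor of the translates of [x] and [y] by [Delta ^+ k];
by cancellation the gcd of the translates is the translate of a common divisor
of [x] and [y]. *)
Lemma le_gcd x y d g : is_gcd (@ldiv M) x y d ->
  le g (iota x) -> le g (iota y) -> le g (iota d).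
Proof.
move=> [dx dy dP] gx gy; have [k [z _ gz]] := fraction_DeltaX g.
have leX t : le g (iota t) -> ldiv z (Delta ^+ k * t).
  by move=> gt; apply/le_iota; rewrite gz gmulfM gmulfXn; apply: le_mul2l.
have [m [mx my mP]] := gaussian_lgcd gaussM (Delta ^+ k * x) (Delta ^+ k * y).
have [d' Em] : ldiv (Delta ^+ k) m by apply: mP; [exists x | exists y].
have cancel t : ldiv m (Delta ^+ k * t) -> ldiv d' t.
  rewrite -Em => -[c]; rewrite -mulgA => /(gaussian_cancell gaussM) <-.
  by exists c.
have d'd : ldiv d' d by apply: dP; apply: cancel.
have /le_iota zm : ldiv z m by apply: mP; apply: leX.
apply: (@le_trans (iota d')); last exact/le_iota.
have := le_mul2l (D ^- k) zm.
by rewrite -Em gmulfM gmulfXn gz !mulKg.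
Qed.

(** * Bounds on conjugates as contraction conditions *)

Definition shift (u : G) (p : int) (g : G) := u^-1 * g * D^ p.

Lemma shift_mono u p g h : le g h -> le (shift u p g) (shift u p h).
Proof. by move=> gh; apply/le_mulDeltaz/le_mul2l. Qed.

Lemma shiftC u p q g : shift u p (shift u q g) = shift u q (shift u p g).
Proof.
by rewrite /shift !mulgA -!(mulgA _ (D^ p)) -!(mulgA _ (D^ q)) commute_expgz.
Qed.

(** Being invertible by another [shift], [shift u q] also reflects the order. *)
Lemma shiftK u q g : shift u^-1 (- q) (shift u q g) = g.
Proof. by rewrite /shift invgK expgzN !mulgA mulgK mulgV mul1g. Qed.

Definition contracted (u : G) (p : int) (g : G) := le (shift u p g) g.

Lemma le_expDelta_conj u p g : le (D^ p) (u ^ g) <-> contracted u p g.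
Proof. by rewrite /contracted /le conjgE /shift !invgM invgK !mulgA. Qed.

(** The two fractions to be compared differ by a conjugation by [D^ q], which
preserves [M]. *)
Lemma le_conj_expDelta u q g : le (u ^ g) (D^ q) <-> contracted u^-1 (- q) g.
Proof.
rewrite /contracted /le conjgE /shift !invgM !invgK expgzN invgK !mulgA.
split=> [/(positiveJ (- q))|/(positiveJ q)].
  by rewrite conjgE expgzN invgK !mulgA mulgK.
by rewrite conjgE !mulgA mulVg mul1g.
Qed.

(** The image of [d] is below the images of [x] and [y], hence below [x] and
[y]; being an element of [G], it is below [d] by [le_gcd]. *)
Lemma contracted_gcd u p x y d : is_gcd (@ldiv M) x y d ->
  contracted u p (iota x) -> contracted u p (iota y) -> contracted u p (iota d).
Proof.
move=> gcd cx cy; have [dx dy _] := gcd.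
by apply: (le_gcd gcd); [apply: le_trans cx | apply: le_trans cy];
   apply/shift_mono/le_iota.
Qed.

Lemma contracted_Delta u p : contracted u p 1 -> contracted u p D.
Proof.
move=> /(le_mulDeltaz (Posz 1)).
rewrite /contracted /shift !mul1g mulg1 -!mulgA.
by rewrite (commute_expgz D p 1).
Qed.

(** Multiplying [g] on the left by a central element does not change [u ^ g]; a
large central power of [Delta] turns [g] into an element of [M]. *)
Lemma conj_positive u g : exists x, u ^ g = u ^ iota x.
Proof.
have [e e_gt0 central] := DeltaX_central; have [k kg] := fraction_DeltaX g.
have centralG (h : G) : commute h (D ^+ e).
  have [x [y ->]] := fractions_div fractionsG h; rewrite -gmulfXn.
  apply/commute_sym/commuteM; first exact/gmulf_commute/commute_sym/central.
  exact/commuteV/gmulf_commute/commute_sym/central.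
have [x _ xE] : positive (D ^+ (k * e) * g).
  rewrite -(subnK (leq_pmulr k e_gt0)) expgnDr -mulgA -gmulfXn.
  by apply: positiveM kg; apply: positive_iota.
exists x; rewrite xE conjgM; congr (_ ^ _).
rewrite conjgE mulnC expgnA.
by rewrite (commuteX k (centralG u)) mulKg.
Qed.

(** * Reaching the best infimum and supremum together *)

Section ConjugacyClasses.

Variable len : M -> nat.
Hypothesis lenP : strict_length len.

(** An element minimal for divisibility is least, since the set is stable under
gcds. *)
Lemma contracted_min u p x : contracted u p (iota x) ->
  exists2 y, contracted u p (iota y) &
    forall g, le 1 g -> contracted u p g -> le (iota y) g.
Proof.
move=> cx.
have [y [cy _] miny] :=
  ldiv_minimal lenP (A := fun y => contracted u p (iota y)) cx.
exists y => // g; rewrite /le invg1 mul1g => -[z _ <-] cz; apply/le_iota.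
have [d gcd] := gaussian_lgcd gaussM y z; have [dy dz _] := gcd.
by rewrite -(miny d (contracted_gcd gcd cy cz) dy).
Qed.

(** The least positive [y] giving the lower bound keeps the upper bound:
[shift u q] commutes with [shift u p], so it maps [y] to another element
contracted by [shift u p], which is above [1] because [1] is below its own
image. *)
Lemma conj_inf_sup u p q x : le u (D^ q) -> le (D^ p) (u ^ iota x) ->
  exists g, le (D^ p) (u ^ g) /\ le (u ^ g) (D^ q).
Proof.
move=> uq /le_expDelta_conj/contracted_min[y cy miny].
exists (iota y); split; first exact/le_expDelta_conj.
have ley : le (iota y) (shift u q (iota y)).
  apply: miny; last by rewrite /contracted shiftC; apply: shift_mono.
  apply: (@le_trans (shift u q 1)).
    by rewrite /le /shift invg1 mul1g mulg1.
  by apply: shift_mono; rewrite /le invg1 mul1g; apply: positive_iota.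
by apply/le_conj_expDelta; have := shift_mono u^-1 (- q) ley; rewrite shiftK.
Qed.

(** * Normal forms and the canonical length *)

Section NontrivialDelta.

Hypothesis Delta_neq1 : Delta <> 1.

Lemma le_expDelta p q : le (D^ p) (D^ q) -> (p <= q)%R.
Proof.
rewrite /le -expgzN -expgzD => -[z _ zE].
case: (boolP (p <= q)%R) => // ltqp; case: Delta_neq1; apply: (ldiv1 lenP).
(* If [q < p], then [Delta ^+ n.+1] times some [z] is [1]. *)
  have [n pq] : exists n, (- p + q)%R = Negz n by exists `|(p - q)%R|.-1; lia.
exists (Delta ^+ n * z); apply: (fractions_inj fractionsG).
by rewrite mulgA -expgS gmulfM gmulfXn zE pq gmulf1 mulgV.
Qed.

Lemma ldiv_expDelta_bound x k : ldiv (Delta ^+ k) x -> (k <= len x)%N.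
Proof.
move=> /(len_ldiv lenP); apply: leq_trans.
exact: len_exp lenP _ _ Delta_neq1.
Qed.

(** Some power [D ^+ k] moves [g] into [M], which gives a candidate; candidates are
bounded because the length of [D ^+ k * g] bounds the powers of [Delta]
dividing it. *)
Lemma inf_exists g : exists p, is_inf iota Delta g p.
Proof.
have [k [z _ zE]] := fraction_DeltaX g.
(* Candidates are counted from [- k], to maximize over natural numbers. *)
pose Q n := `[< positive (D^ (- (n%:Z - k%:Z))%R * g) >].
have Q0 : exists n, Q n.
  exists 0; apply/asboolP; exists z => //; rewrite zE.
  by have ->: (- (0%:Z - k%:Z))%R = Posz k by lia.
have Qb n : Q n -> (n <= len z)%N.
  move=> /asboolP[m _ mE]; apply: ldiv_expDelta_bound; exists m.
  apply: (fractions_inj fractionsG).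
  rewrite gmulfM gmulfXn mE zE mulgA; congr (_ * g).
  by rewrite -[D ^+ n]/(D^ n%:Z) -expgzD -[D ^+ k]/(D^ k%:Z); congr expgz; lia.
case: (ex_maxnP Q0 Qb) => n /asboolP Qn maxn.
exists (n%:Z - k%:Z)%R; split=> // r posr.
have [rk | ltkr] := boolP (r <= - k%:Z)%R; first by lia.
have rE : r = (`|(r + k%:Z)%R|%N%:Z - k%:Z)%R by lia.
have /maxn : Q `|(r + k%:Z)%R|%N by apply/asboolP; rewrite -rE.
by lia.
Qed.

(** The condition on the entries in a left normal form, detached from the power of
[Delta] so that it passes to tails. *)
Definition left_weighted (s : seq M) := forall i, (i < size s)%N ->
  [/\ simple Delta s`_i, s`_i <> 1, s`_i <> Delta &
      is_gcd (@ldiv M) Delta (\prod_(x <- drop i s) x) s`_i].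

Lemma left_weighted_tail x s : left_weighted (x :: s) -> left_weighted s.
Proof. by move=> wxs i i_lt; apply: (wxs i.+1). Qed.

Lemma simple_ldiv x :
  x <> 1 -> exists y, [/\ simple Delta y, y <> 1 & ldiv y x].
Proof.
have [s [sS <-]] := garside_generates garsideD x.
elim: s sS => [|y s IHs] sS; first by rewrite big_nil.
rewrite big_cons; have [-> | y_neq1 _] := eqVneq y 1.
  by rewrite mul1g; apply: IHs => t ts; apply: sS; rewrite inE ts orbT.
exists y; split; [by apply: sS; rewrite mem_head | exact/eqP |].
by exists (\prod_(x <- s) x).
Qed.

Lemma gcd_Delta_neq1 x d : x <> 1 -> is_gcd (@ldiv M) Delta x d -> d <> 1.
Proof.
move=> /simple_ldiv[y [yS y_neq1 yx]] [_ _ dP] d1.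
by apply/y_neq1/(ldiv1 lenP); rewrite -d1; apply: dP.
Qed.

(** Splitting off the gcd with [Delta] shortens [x].  This gcd is never [Delta]: a
[Delta] dividing a tail could be slid to the front. *)
Lemma left_weighted_exists x : ~ ldiv Delta x ->
  exists2 s, left_weighted s & \prod_(y <- s) y = x.
Proof.
have [n] := ubnP (len x); elim: n x => // n IHn x; rewrite ltnS => lexn Dx.
have [-> | /eqP x_neq1] := eqVneq x 1.
  by exists [::]; rewrite ?big_nil.
have [d gcd] := gaussian_lgcd gaussM Delta x.
have d_neq1 := gcd_Delta_neq1 x_neq1 gcd; have [dS [y dy] _] := gcd.
have [||s ws sy] := IHn y.
- by apply: leq_trans lexn; rewrite -dy; apply: len_ltMr.
- move=> [c Dc]; apply: Dx; have [e de] := slide d.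
  by exists (e * c); rewrite mulgA -de -mulgA Dc.
exists (d :: s); last by rewrite big_cons sy.
case=> [|i] /= i_lt; last exact: ws.
rewrite big_cons sy dy; split=> //.
by move=> dD; apply: Dx; exists y; rewrite -dD.
Qed.

(** The fraction [y * x * Delta ^- k] is below both [Delta] and [y * x], hence
below their gcd [y]; cancel [y] on the left. *)
Lemma ldiv_gcd_tail y x k : is_gcd (@ldiv M) Delta (y * x) y ->
  ldiv (y * x) (Delta ^+ k.+1) -> ldiv x (Delta ^+ k).
Proof.
move=> gcd /le_iota; rewrite gmulfXn => yxk.
have : le (iota (y * x) * D^ (- k%:Z)%R) (iota y).
  apply: (le_gcd gcd).
    have := le_mulDeltaz (- k%:Z)%R yxk.
    by rewrite expgzN expgS mulgK.
  rewrite /le expgzN invgM invgK mulgVK /= -gmulfXn.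
  exact: positive_iota.
move=> /(le_mul2l (iota y)^-1)/(le_mulDeltaz k%:Z).
rewrite gmulfM -!mulgA !mulKg expgzN mulVg mulg1.
by rewrite /= -gmulfXn => /le_iota.
Qed.

Lemma left_weighted_size s k : left_weighted s ->
  ldiv (\prod_(x <- s) x) (Delta ^+ k) -> (size s <= k)%N.
Proof.
elim: s k => // y s IHs k ws.
have [_ y_neq1 _] := ws 0%N isT; rewrite /= big_cons => gcd.
case: k => [|k] yk.
  by case: y_neq1; apply: (ldiv1 lenP); apply: ldiv_trans yk; have [] := gcd.
exact/(IHs _ (left_weighted_tail ws))/ldiv_gcd_tail/yk.
Qed.

Definition between p q g := le (D^ p) g /\ le g (D^ q).

Local Notation cl := (canonical_length iota Delta).

(** Existence of a normal form ensures that the choice defining the canonical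
length does not fall back to its default value. *)
Lemma canonical_normal_form g :
  exists p s, left_normal_form iota Delta g p s /\ size s = cl g.
Proof.
suff ex : exists l, [set l | exists p s, left_normal_form iota Delta g p s /\
    size s = l]%classic l by exact: (xgetPex 0%N ex).
have [p infp] := inf_exists g; have [[x _ xE] maxp] := infp.
have [|s ws sx] := @left_weighted_exists x.
  move=> [y yx]; suff /maxp : positive (D^ (- (p + 1))%R * g) by lia.
  exists y => //; rewrite (_ : (- (p + 1))%R = (- 1 - p)%R); last by lia.
  by rewrite expgzD -mulgA -xE -yx gmulfM mulKg.
exists (size s), p, s; split=> //; split=> //.
by rewrite sx xE expgzN mulVKg.
Qed.

Lemma canonical_length_between g : exists p, between p (p + (cl g)%:Z)%R g.
Proof.
have [p [s [[_ gE ws] <-]]] := canonical_normal_form g.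
exists p; rewrite {}gE; split; first exact/le_mulr/positive_iota.
rewrite expgzD; apply: le_mul2l; rewrite /= -gmulfXn; apply/le_iota.
apply: simple_prod_ldiv => x /(nthP 1)[i /ws[xS _ _ _] <-].
exact: xS.
Qed.

Lemma canonical_length_le p q g : between p q g -> ((cl g)%:Z <= q - p)%R.
Proof.
move=> [pg gq]; have [p0 [s [[[_ maxp0] gE ws] <-]]] := canonical_normal_form g.
have pp0 : (p <= p0)%R by apply: maxp0; rewrite expgzN.
rewrite gE in gq.
have p0q : (p0 <= q)%R.
  by apply: le_expDelta; apply: le_trans gq; apply/le_mulr/positive_iota.
have [k qE] : exists k : nat, q = (p0 + k%:Z)%R by exists `|(q - p0)%R|%N; lia.
suff : (size s <= k)%N by lia.
apply: (left_weighted_size ws); apply/le_iota; rewrite gmulfXn.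
by have := le_mul2l (D^ p0)^-1 gq; rewrite qE expgzD !mulKg.
Qed.

(** * Elements of minimal canonical length *)

Variable a : G.

Local Notation Cs := (Csum iota Delta a).

Lemma Csum_conj u g : Cs u -> (cl (u ^ g) <= cl u)%N -> Cs (u ^ g).
Proof.
move=> [[h uE] minu] le_cl; split; first by exists (h * g); rewrite conjgM uE.
by move=> w /minu; apply: leq_trans.
Qed.

Lemma Csum_min u g : Cs u -> (cl u <= cl (u ^ g))%N.
Proof.
by move=> [[h uE] minu]; apply: minu; exists (h * g); rewrite conjgM uE.
Qed.

Lemma Csum_conjugate u v : Cs u -> Cs v -> exists x, v = u ^ iota x.
Proof.
move=> [[h ->] _] [[k ->] _]; have [x xE] := conj_positive (a ^ h) (h^-1 * k).
by exists x; rewrite -xE conjgM conjgK.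
Qed.

(** Otherwise [conj_inf_sup] would provide a conjugate of [u] with the supremum of
[u] and a larger infimum, hence shorter than [u]. *)
Lemma Csum_inf_max u p v r : Cs u -> Cs v -> between p (p + (cl u)%:Z)%R u ->
  le (D^ r) v -> (r <= p)%R.
Proof.
move=> Cu Cv [_ uq]; have [x ->] := Csum_conjugate Cu Cv.
move=> /(conj_inf_sup uq)[g /canonical_length_le].
have := Csum_min g Cu; lia.
Qed.

Lemma Csum_between u v : Cs u -> Cs v ->
  exists p, between p (p + (cl u)%:Z)%R u /\ between p (p + (cl u)%:Z)%R v.
Proof.
move=> Cu Cv; have eq_cl : cl v = cl u.
  apply/eqP; rewrite eqn_leq; case: Cu Cv => [cu minu] [cv minv].
  by rewrite minu ?minv.
have [p bu] := canonical_length_between u.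
have [r bv] := canonical_length_between v.
suff rp : r = p by exists p; split=> //; rewrite -eq_cl -{2}rp -rp.
apply/eqP; rewrite Order.POrderTheory.eq_le.
by rewrite (Csum_inf_max Cu Cv bu bv.1) (Csum_inf_max Cv Cu bv bu.1).
Qed.

(** Both [x] and [Delta] conjugate [u] to elements with the bounds of [u], and the
conjugators with this property are stable under gcds. *)
Lemma Csum_gcd_Delta u x d : Cs u -> Cs (u ^ iota x) ->
  is_gcd (@ldiv M) Delta x d -> Cs (u ^ iota d).
Proof.
move=> Cu Cux gcd; have [p [[pu uq] [pux uxq]]] := Csum_between Cu Cux.
apply: Csum_conj => //.
suff /canonical_length_le : between p (p + (cl u)%:Z)%R (u ^ iota d) by lia.
split.
  apply/le_expDelta_conj/(contracted_gcd gcd); last exact/le_expDelta_conj.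
  by apply/contracted_Delta/le_expDelta_conj; rewrite conjg1.
apply/le_conj_expDelta/(contracted_gcd gcd); last exact/le_conj_expDelta.
by apply/contracted_Delta/le_conj_expDelta; rewrite conjg1.
Qed.

(** The gcd of [x] and [Delta] is a nontrivial simple element with the required
property; a minimal such divisor of it is minimal among all simple elements. *)
Lemma Ssum_ldiv u x : Cs u -> Cs (u ^ iota x) -> x <> 1 ->
  exists2 s, Ssum iota Delta a u s & ldiv s x.
Proof.
move=> Cu Cux x_neq1; have [d gcd] := gaussian_lgcd gaussM Delta x.
pose A s := Psum iota Delta a u s /\ s <> 1.
have Ad : A d.
  split; last exact: gcd_Delta_neq1 gcd.
  by split; [have [] := gcd | apply: Csum_gcd_Delta gcd].
have [s [[Ps s_neq1] sd] mins] := ldiv_minimal lenP Ad.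
exists s; last by apply: ldiv_trans sd _; have [] := gcd.
by split=> // t Pt t_neq1; apply: mins.
Qed.

(** * Connecting conjugators by minimal simple steps *)

Definition Ssum_connected u v := exists (k : nat) (w : nat -> G),
  [/\ (1 <= k)%N, w 1%N = u, w k = v,
      forall i : nat, (1 <= i <= k)%N -> Cs (w i) &
      forall i : nat, (1 <= i < k)%N ->
        exists2 s : M, Ssum iota Delta a (w i) s &
          w i.+1 = (iota s)^-1 * w i * iota s].

Lemma Ssum_connected_refl u : Cs u -> Ssum_connected u u.
Proof.
move=> Cu; exists 1%N, (fun=> u); split=> // i.
by case: i.
Qed.

Lemma Ssum_connected_step u s v : Cs u -> Ssum iota Delta a u s ->
  Ssum_connected (u ^ iota s) v -> Ssum_connected u v.
Proof.
move=> Cu Ss [k [w [k_ge1 w1 wk Cw step]]].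
exists k.+1, (fun i => if i is j.+2 then w j.+1 else u); split=> //.
- by case: k k_ge1 wk {Cw step}.
- by case=> [|[|i]] // i_le; apply: Cw.
case=> [|[|i]] // i_lt; last exact: step.
by exists s; rewrite // w1 conjgE mulgA.
Qed.

(** Induction on the length of [x], splitting off a minimal simple divisor. *)
Lemma Csum_connected u x : Cs u -> Cs (u ^ iota x) ->
  Ssum_connected u (u ^ iota x).
Proof.
have [n] := ubnP (len x); elim: n u x => // n IHn u x.
rewrite ltnS => lexn Cu Cux.
have [-> | /eqP x_neq1] := eqVneq x 1.
  by rewrite gmulf1 conjg1; apply: Ssum_connected_refl.
have [s Ss [y sy]] := Ssum_ldiv Cu Cux x_neq1; have [[_ Cus] s_neq1 _] := Ss.
apply: (Ssum_connected_step Cu Ss).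
have ltyx : (len y < n)%N.
  by apply: leq_trans lexn; rewrite -sy; apply: len_ltMr.
by move: Cux; rewrite -sy gmulfM conjgM; apply: IHn.
Qed.

End NontrivialDelta.

(** When [Delta = 1] no element has a normal form, but then the group is trivial. *)
Lemma trivial_fractions : Delta = 1 -> forall g : G, g = 1.
Proof.
move=> D1 g; have trivM (x : M) : x = 1.
  by have [k] := ldiv_DeltaX x; rewrite D1 expg1n => /(ldiv1 lenP).
have [x [y ->]] := fractions_div fractionsG g.
by rewrite (trivM x) (trivM y) mulgV.
Qed.

End ConjugacyClasses.

End Fractions.

End Garside.

Theorem proposition4p14 (M : monoidType) (Delta : M) (G : groupType)
    (iota : UMagmaMorphism.type M G)
    (garsideM : garside_monoid Delta) (fractionsG : group_of_fractions iota)
    (a u v : G) (Cu : Csum iota Delta a u) (Cv : Csum iota Delta a v) :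
  exists (k : nat) (w : nat -> G),
    [/\ (1 <= k)%N, w 1%N = u, w k = v,
        forall i : nat, (1 <= i <= k)%N -> Csum iota Delta a (w i) &
        forall i : nat, (1 <= i < k)%N ->
          exists2 s : M, Ssum iota Delta a (w i) s &
            w i.+1 = (iota s)^-1 * w i * iota s].
Proof.
have [len lenP] := atomic_length (gaussian_atomic garsideM.1).
have [D1 | /eqP Delta_neq1] := eqVneq Delta 1.
  have triv := trivial_fractions garsideM fractionsG lenP D1.
  by rewrite (triv v) -(triv u); apply: Ssum_connected_refl.
have [x vE] := Csum_conjugate garsideM fractionsG Cu Cv; subst v.
exact: Csum_connected lenP Delta_neq1 _ _ _ Cu Cv.
Qed.
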